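(* For all $n \geq 0$ and $k \geq 2$, $a_{2n+1}(132, 341256\cdots(k+2)) = s_n(132, 2134\cdots k)$, where $341256\cdots(k+2)$ denotes the permutation of length $k+2$ with entries $3,4,1,2$ followed by $5,6,\dots,k+2$ in increasing order (so it is $3412$ when $k=2$), and $2134\cdots k$ denotes the permutation of length $k$ with entries $2,1$ followed by $3,4,\dots,k$ in increasing order (so it is $21$ when $k=2$).
   Context: A permutation $w = w_1w_2\cdots w_n$ of length $n$ is a sequence containing each of the integers $1,\dots,n$ exactly once (for $n=0$ there is exactly one, the empty permutation). It is alternating if $w_1 < w_2 > w_3 < w_4 > \cdots$. A sequence $w = w_1\cdots w_n$ of distinct integers contains a permutation $p$ of length $m$ (a pattern) if there are indices $1 \le i_1 < \cdots < i_m \le n$ such that $w_{i_1}\cdots w_{i_m}$ is order-isomorphic to $p$ (same relative order of entries); otherwise $w$ avoids $p$. $s_n(r_1,\dots,r_m)$ is the number of permutations of length $n$ avoiding all of the patterns $r_1,\dots,r_m$, and $a_n(r_1,\dots,r_m)$ is the number of alternating permutations of length $n$ avoiding all of the patterns $r_1,\dots,r_m$. *)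

(* Defs.v *)
From mathcomp Require Import all_boot.

Set Implicit Arguments.
Unset Strict Implicit.
Unset Printing Implicit Defensive.

(* A permutation of length n is a word in the letters 1, ..., n (one-line
   notation), so the permutations of length n are the elements of
   [permutations (iota 1 n)]. Positions in words are numbered from 0. *)

Definition alternating (w : seq nat) : bool :=
  [forall i : 'I_(size w).-1,
    if odd i then nth 0 w i > nth 0 w i.+1 else nth 0 w i < nth 0 w i.+1].

Definition contains (w p : seq nat) : bool :=
  [exists f : {ffun 'I_(size p) -> 'I_(size w)},
    [forall i : 'I_(size p), forall j : 'I_(size p), (i < j) ==> (f i < f j)] &&
    [forall i : 'I_(size p), forall j : 'I_(size p),
      (nth 0 w (f i) < nth 0 w (f j)) == (nth 0 p i < nth 0 p j)]].

Definition avoids_all (rs : seq (seq nat)) (w : seq nat) : bool :=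
  all (fun r => ~~ contains w r) rs.

Definition s_ (n : nat) (rs : seq (seq nat)) : nat :=
  count (avoids_all rs) (permutations (iota 1 n)).

Definition a_ (n : nat) (rs : seq (seq nat)) : nat :=
  count (fun w => alternating w && avoids_all rs w) (permutations (iota 1 n)).

Definition pat132 : seq nat := [:: 1; 3; 2].

(* 3 4 1 2 5 6 ... (k+2), for k >= 2 *)
Definition pat341256 (k : nat) : seq nat := [:: 3; 4; 1; 2] ++ iota 5 (k - 2).

(* 2 1 3 4 ... k, for k >= 2 *)
Definition pat2134 (k : nat) : seq nat := [:: 2; 1] ++ iota 3 (k - 2).

(* Main.v *)
(* In a 132-avoiding word L m R with maximum m every letter of L exceeds every
   letter of R, so 132-avoiders of length n correspond to binary trees with n
   nodes. The word is alternating of odd length exactly when the tree is full,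
   and full trees with 2n+1 nodes arise from arbitrary trees with n nodes by
   attaching the missing leaves. Appending a new maximum to a pattern p gives
   a pattern contained in L m R iff p is in L or the new pattern is in R; hence
   the two families of patterns obey the same recursion along this bijection,
   starting from 21 in L m R iff (21 in L or R nonempty) and, for nonempty L,
   3412 in L m R iff (3412 in L or 12 in R). *)

From HB Require Import structures.
Require Import Defs.
From mathcomp Require Import all_boot.
From mathcomp Require Import zify.

Set Implicit Arguments.
Unset Strict Implicit.
Unset Printing Implicit Defensive.

(** * Pattern containment through subsequences *)

Lemma subseq_catP (T : eqType) (s L R : seq T) :
  reflect (exists s1 s2, [/\ s = s1 ++ s2, subseq s1 L & subseq s2 R])
    (subseq s (L ++ R)).
Proof.
apply: (iffP idP) => [|[s1 [s2 [-> h1 h2]]]]; last exact: cat_subseq.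
elim: L s => [|x L IH] s /=; first by exists [::], s.
case: s => [|y s]; first by exists [::], [::]; rewrite !sub0seq.
case: eqP => [->|ne] /IH [s1 [s2 [e h1 h2]]].
  by exists (x :: s1), s2; rewrite e /= eqxx.
exists s1, s2; split=> //.
exact: subseq_trans h1 (subseq_cons _ _).
Qed.

Definition order_iso (s p : seq nat) : Prop :=
  size s = size p /\ forall i j, i < size p -> j < size p ->
    (nth 0 s i < nth 0 s j) = (nth 0 p i < nth 0 p j).

(** Trades the embedding of positions for the subword it selects, so that occurrences can be cut
    along concatenations. *)
Lemma containsP w p :
  reflect (exists2 s, subseq s w & order_iso s p) (contains w p).
Proof.
apply: (iffP existsP) => [[f /andP [/forallP mono /forallP iso]]|];
  last move=> [s /subseqP [m sm es] [sz iso]].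
  pose t := [seq val (f i) | i <- enum 'I_(size p)].
  have st : sorted ltn t.
    rewrite sorted_map.
    have: sorted ltn (map val (enum 'I_(size p))).
      by rewrite val_enum_ord iota_ltn_sorted.
    rewrite sorted_map; apply: sub_sorted => i j /= ij.
    exact: (implyP (forallP (mono i) j)).
  (* A strictly increasing list is determined by its members; this exhibits the chosen positions [t]
     as a subsequence of all positions. *)
  have et : t = filter (mem t) (iota 0 (size w)).
    apply: (irr_sorted_eq ltn_trans ltnn) => //.
      exact: sorted_filter ltn_trans _ _ (iota_ltn_sorted _ _).
    move=> i; rewrite mem_filter mem_iota /= add0n.
    by case: (boolP (i \in t)) => // /mapP [j _ ->]; rewrite ltn_ord.
  exists (map (nth 0 w) t).
    rewrite -[X in subseq _ X](mkseq_nth 0 w) /mkseq.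
    by apply: map_subseq; rewrite et filter_subseq.
  split; first by rewrite size_map size_map size_enum_ord.
  have nthE i (hi : i < size p) :
      nth 0 (map (nth 0 w) t) i = nth 0 w (f (Ordinal hi)).
    rewrite /t -map_comp (nth_map (Ordinal hi)) ?size_enum_ord //=.
    by have /= -> := nth_ord_enum (Ordinal hi) (Ordinal hi).
  move=> i j hi hj; rewrite !nthE.
  exact: (eqP (forallP (iso (Ordinal hi)) (Ordinal hj))).
(* The mask that selects [s] from [w] is applied to the positions, which yields the embedding. *)
pose t := mask m (iota 0 (size w)).
have st : sorted ltn t by apply: sorted_mask (iota_ltn_sorted _ _); apply: ltn_trans.
have est : s = map (nth 0 w) t.
  by rewrite es -[in LHS](mkseq_nth 0 w) /mkseq map_mask.
have szt : size t = size p by rewrite -sz est size_map.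
have bt i : i < size p -> nth 0 t i < size w.
  rewrite -szt => hi; have := mem_mask (mem_nth 0 hi).
  by rewrite mem_iota add0n.
exists [ffun i : 'I_(size p) => Ordinal (bt i (ltn_ord i))].
apply/andP; split; apply/forallP => i; apply/forallP => j; rewrite !ffunE /=.
  apply/implyP => ij; apply: (sorted_ltn_nth ltn_trans 0 st) => //;
  by rewrite inE szt.
by rewrite -iso // est !(nth_map 0) ?szt.
Qed.

Lemma subseq_contains L w p : subseq L w -> contains L p -> contains w p.
Proof.
move=> h /containsP [s hs iso]; apply/containsP; exists s => //.
exact: subseq_trans hs h.
Qed.

Lemma order_iso_rcons s x p t : all (ltn^~ t) p ->
  order_iso (rcons s x) (rcons p t) <-> order_iso s p /\ all (ltn^~ x) s.
Proof.
move=> /(all_nthP 0) pt; split=> [[]|[[sz iso] /(all_nthP 0) sx]].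
  rewrite !size_rcons => -[sz] iso; split; [split=> //|] => [i j hi hj|].
    by have := iso i j (ltnW hi) (ltnW hj); rewrite !nth_rcons sz hi hj.
  apply/(all_nthP 0) => i; rewrite sz => hi /=.
  have := iso i (size p) (ltnW hi) (ltnSn _).
  by rewrite !nth_rcons sz hi ltnn eqxx => ->; apply: pt.
split=> [|i j]; first by rewrite !size_rcons sz.
rewrite size_rcons !ltnS !nth_rcons sz (leq_eqVlt i) (leq_eqVlt j).
have ltp i' : i' < size p -> nth 0 s i' < x by rewrite -sz => /sx.
case/predU1P => [->|hi]; case/predU1P => [->|hj]; rewrite ?ltnn ?eqxx.
- by [].
- by rewrite hj; have := ltp j hj; have /= := pt j hj; lia.
- by rewrite hi; have := ltp i hi; have /= := pt i hi; lia.
- by rewrite hi hj iso.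
Qed.

Lemma contains_21 w :
  reflect (exists a b, subseq [:: b; a] w /\ a < b) (contains w [:: 2; 1]).
Proof.
apply: (iffP (containsP _ _)) => [[s sw [sz iso]]|[a [b [sw ab]]]].
  case: s sz sw iso => [|b [|a []]] // _ sw iso.
  by exists a, b; split=> //; rewrite (iso 1 0).
by exists [:: b; a] => //; split=> // -[|[|i]] [|[|j]] //=; lia.
Qed.

Lemma contains_132 w :
  reflect (exists a b c, subseq [:: a; c; b] w /\ a < b < c) (contains w pat132).
Proof.
apply: (iffP (containsP _ _)) => [[s sw [sz iso]]|[a [b [c [sw /andP [ab bc]]]]]].
  case: s sz sw iso => [|a [|c [|b []]]] // _ sw iso.
  by exists a, b, c; split=> //; rewrite (iso 0 2) ?(iso 2 1).
by exists [:: a; c; b] => //; split=> // -[|[|[|i]]] [|[|[|j]]] //=; lia.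
Qed.

Lemma contains_12 w :
  reflect (exists a b, subseq [:: a; b] w /\ a < b) (contains w [:: 1; 2]).
Proof.
apply: (iffP (containsP _ _)) => [[s sw [sz iso]]|[a [b [sw ab]]]].
  case: s sz sw iso => [|a [|b []]] // _ sw iso.
  by exists a, b; split=> //; rewrite (iso 0 1).
by exists [:: a; b] => //; split=> // -[|[|i]] [|[|j]] //=; lia.
Qed.

Lemma contains_3412 w :
  reflect (exists a b c d, subseq [:: c; d; a; b] w /\ [/\ a < b, b < c & c < d])
    (contains w [:: 3; 4; 1; 2]).
Proof.
apply: (iffP (containsP _ _)) => [[s sw [sz iso]]|[a [b [c [d [sw [ab bc cd]]]]]]].
  case: s sz sw iso => [|c [|d [|a [|b []]]]] // _ sw iso.
  by exists a, b, c, d; split=> //; rewrite (iso 2 3) ?(iso 3 0) ?(iso 0 1).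
by exists [:: c; d; a; b] => //; split=> // -[|[|[|[|i]]]] [|[|[|[|j]]]] //=; lia.
Qed.

(** * Containment in a word split at its maximum *)

Definition skew_node (L : seq nat) (m : nat) (R : seq nat) : Prop :=
  [/\ forall x, x \in L -> x < m, forall y, y \in R -> y < m
    & forall x y, x \in L -> y \in R -> y < x].

Section SkewNode.

Variables (L R : seq nat) (m : nat).
Hypothesis node : skew_node L m R.

Let subL : subseq L (L ++ m :: R). Proof. exact: prefix_subseq. Qed.
Let subR : subseq R (L ++ m :: R).
Proof. exact: subseq_trans (subseq_cons _ _) (suffix_subseq _ _). Qed.

(** An occurrence of [p] in [L] is completed by [m]. Conversely, look at the last letter of an
    occurrence: in [R], it lies below every letter of [L], so an occurrence meeting [R] in its last
    letter only, or ending at [m], has its copy of [p] in [L], and any other is confined to one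
    side. *)
Lemma contains_node_rcons p t : all (ltn^~ t) p -> p != [::] ->
  contains (L ++ m :: R) (rcons p t) = contains L p || contains R (rcons p t).
Proof.
case: node => Lm Rm LR pt p0.
apply/idP/orP => [/containsP [s]|[/containsP [s sL iso]|]].
- case/lastP: s => [|s x sw]; first by move=> _ []; rewrite size_rcons.
  move=> iso; have [iso' sx] := (order_iso_rcons s x pt).1 iso.
  have [a sa] : exists a, a \in s.
    case: (s) iso' p0 => [[]|a l _ _]; first by case: (p).
    by exists a; rewrite inE eqxx.
  have ax : a < x := allP sx _ sa.
  case/subseq_catP: sw => s1 [s2 [e h1 h2]].
  case/lastP: s2 e h2 => [|s2 y].
    rewrite cats0 => e _; left; apply/containsP; exists s => //.
    by apply: subseq_trans h1; rewrite -e subseq_rcons.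
  rewrite -rcons_cat => /rcons_inj [es <-] h2; rewrite es in sa sx iso' iso *.
  (* If [x] is the only letter taken from [m :: R], then [s1] is a copy of [p] in [L]. Otherwise [x]
     comes after another such letter, hence lies in [R]. *)
  case: s2 es iso iso' sa sx h2 => [|z s2] es iso iso' sa sx /= h2.
    by rewrite cats0 in iso'; left; apply/containsP; exists s1.
  have xR : x \in R.
    have := mem_subseq h2.
    by case: ifP => _ /(_ x); apply; rewrite ?inE mem_rcons inE eqxx ?orbT.
  have s10 : s1 = [::].
    case: (s1) sx h1 => // b l /andP [bx _] /mem_subseq h1.
    have := LR b x (h1 b (mem_head _ _)) xR; rewrite /= in bx; lia.
  right; apply/containsP; exists (rcons (z :: s2) x); last by rewrite s10 in iso.
  (* The first letter [z] is not [m], because it is smaller than [x]. *)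
  move: h2; case: eqP => //= ez _.
  have : z < x by apply: (allP sx); rewrite mem_cat mem_head orbT.
  by rewrite ez ltnNge ltnW // Rm.
- apply/containsP; exists (rcons s m).
    by rewrite -cats1; apply: cat_subseq => //=; rewrite eqxx sub0seq.
  apply/order_iso_rcons => //; split=> //.
  by apply/allP => x /(mem_subseq sL) /Lm.
- exact: subseq_contains.
Qed.

(** Any letter of [R] forms a descent with [m]; if [R] is empty, [m] is both last and largest and
    takes part in none. *)
Lemma contains_node_21 :
  contains (L ++ m :: R) [:: 2; 1] = contains L [:: 2; 1] || (R != [::]).
Proof.
case: node => Lm Rm LR.
apply/idP/orP => [/contains_21 [a [b [/subseq_catP [s1 [s2 [e h1 h2]]] ab]]]|[|]].
- move: s1 e h1 => [|x1 [|x2 [|x3 s1]]] //= [].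
  + move=> e; rewrite -{s2}e in h2 => _; right; move: h2 => /=.
    by case: ifP => _; case: (R).
  + move=> <- e; rewrite -{s2}e in h2; rewrite sub1seq => bL; right.
    move: h2 => /=; case: eqP => [am _|_]; last by case: (R).
    by have := Lm _ bL; lia.
  + by move=> <- <- _ h1; left; apply/contains_21; exists a, b.
- exact: subseq_contains.
- case: (R) Rm => // y R' /(_ y (mem_head _ _)) ym _.
  apply/contains_21; exists y, m; split=> //.
  apply: (subseq_trans _ (suffix_subseq _ _)).
  by rewrite /= !eqxx sub0seq.
Qed.

(** The letter playing 2 is not [m]. In [L] it keeps the whole occurrence in [L]; in [R] it forces
    the smaller letter playing 1, and so everything, into [R]. *)
Lemma contains_node_132 :
  contains (L ++ m :: R) pat132 = contains L pat132 || contains R pat132.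
Proof.
case: node => Lm Rm LR.
apply/idP/orP => [/contains_132|[]]; [|exact: subseq_contains..].
move=> [a [b [c [/subseq_catP [s1 [s2 [e h1 h2]]] /andP [ab bc]]]]].
move: s1 e h1 => [|x1 [|x2 [|x3 s1]]] //= [].
- move=> e; rewrite -{s2}e in h2 => _; right.
  move: h2; rewrite [subseq _ _]/=; case: eqP => [am|_ h2].
    move=> /mem_subseq /(_ c); rewrite inE eqxx => /(_ isT) /Rm; lia.
  by apply/contains_132; exists a, b, c; rewrite ab bc.
- move=> <- e; rewrite -{s2}e in h2; rewrite sub1seq => aL.
  have bR : b \in R.
    move: h2; rewrite [subseq _ _]/=.
    by case: ifP => _ /mem_subseq /(_ b); apply; rewrite !inE eqxx ?orbT.
  by have := LR _ _ aL bR; lia.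
- move=> <- <- e /mem_subseq h1; rewrite -{s2}e sub1seq inE in h2.
  have aL : a \in L by apply: h1; rewrite !inE eqxx.
  have cL : c \in L by apply: h1; rewrite !inE eqxx orbT.
  case/orP: h2 => [/eqP|] hb; first by have := Lm _ cL; lia.
  by have := LR _ _ aL hb; lia.
- move=> <- <- <- _ h1; left; apply/contains_132; exists a, b, c.
  rewrite ab bc; split=> //; apply: subseq_trans h1.
  by rewrite /= !eqxx sub0seq.
Qed.

(** A letter of [L] followed by [m] plays 34 in front of any 12 in [R]. Conversely, the letter
    playing 2 is not [m]; in [L] it keeps the occurrence in [L], and in [R] it forces the smaller
    letter playing 1 into [R]. *)
Lemma contains_node_3412 : L != [::] ->
  contains (L ++ m :: R) [:: 3; 4; 1; 2] =
  contains L [:: 3; 4; 1; 2] || contains R [:: 1; 2].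
Proof.
case: node => Lm Rm LR L0.
apply/idP/orP => [/contains_3412|[|]]; last 2 first.
- exact: subseq_contains.
- move=> /contains_12 [a [b [h ab]]]; apply/contains_3412.
  have bR : b \in R by apply: (mem_subseq h); rewrite !inE eqxx orbT.
  case: (L) L0 Lm LR => // x L' _ Lm' LR'.
  exists a, b, x, m; split; last by split=> //; [apply: LR'|apply: Lm'];
    rewrite ?mem_head.
  by rewrite -[[:: x; m; a; b]]/([:: x] ++ m :: [:: a; b]);
    apply: cat_subseq; rewrite /= eqxx ?sub0seq.
move=> [a [b [c [d [/subseq_catP [s1 [s2 [e h1 h2]]] [ab bc cd]]]]]].
have in12 : subseq [:: a; b] R -> contains R [:: 1; 2].
  by move=> h; apply/contains_12; exists a, b.
have drop1 x s s' : subseq (x :: s) (m :: s') -> subseq s s'.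
  by rewrite /=; case: ifP => // _ /cons_subseq.
move: s1 e h1 => [|x1 [|x2 [|x3 [|x4 s1]]]] //= [].
- move=> e _; rewrite -{s2}e in h2; right; apply: in12.
  by apply: cons_subseq; apply: drop1 h2.
- move=> _ e _; rewrite -{s2}e in h2; right; apply: in12.
  exact: drop1 h2.
- move=> _ _ e _; rewrite -{s2}e in h2; right; apply: in12.
  move: (h2); rewrite [subseq _ _]/=; case: eqP => // am.
  by rewrite sub1seq => /Rm; lia.
- move=> ec ed ea e; subst x1 x2 x3 s2; move=> /mem_subseq h1.
  have aL : a \in L by apply: h1; rewrite !inE eqxx !orbT.
  have cL : c \in L by apply: h1; rewrite !inE eqxx.
  move: h2; rewrite sub1seq inE => /orP [/eqP hb|hb].
    by have := Lm _ cL; lia.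
  by have := LR _ _ aL hb; lia.
- move=> <- <- <- <- _ h1; left; apply/contains_3412; exists a, b, c, d.
  split=> //; apply: subseq_trans h1; by rewrite /= !eqxx sub0seq.
Qed.

End SkewNode.

(** * Binary trees and 132-avoiding words *)

Inductive btree := Leaf | Node of btree & btree.

Definition btree_eq_dec : comparable btree.
Proof. by move=> t t'; rewrite /decidable; decide equality. Defined.
HB.instance Definition _ := hasDecEq.Build btree (compareP btree_eq_dec).

Fixpoint nodes t := if t is Node l r then (nodes l + nodes r).+1 else 0.

(* A word in the letters o+1, ..., o + nodes t. *)
Fixpoint word t o : seq nat :=
  if t is Node l r then
    word l (o + nodes r) ++ (o + (nodes l + nodes r).+1) :: word r o
  else [::].

(** [Leaf] is the empty tree, so each missing child becomes a childless node and the result is a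
    full tree. *)
Fixpoint fill t :=
  if t is Node l r then Node (fill l) (fill r) else Node Leaf Leaf.

Lemma nodes_fill t : nodes (fill t) = 2 * nodes t + 1.
Proof. by elim: t => //= l -> r ->; lia. Qed.

Lemma size_word t o : size (word t o) = nodes t.
Proof. by elim: t o => //= l IHl r IHr o; rewrite size_cat /= IHl IHr addnS. Qed.

Lemma mem_word t o x : (x \in word t o) = (o < x <= o + nodes t).
Proof.
elim: t o => [|l IHl r IHr] o /=; first by rewrite in_nil; lia.
by rewrite mem_cat inE IHl IHr; lia.
Qed.

Lemma word_node l r o :
  skew_node (word l (o + nodes r)) (o + (nodes l + nodes r).+1) (word r o).
Proof. by split=> [x|x|x y]; rewrite !mem_word; lia. Qed.

Lemma word_perm t o : perm_eq (word t o) (iota o.+1 (nodes t)).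
Proof.
have uw : uniq (word t o).
  elim: t o => //= l IHl r IHr o; rewrite cat_uniq IHl /= IHr andbT mem_word.
  rewrite negb_or -!andbA mem_word; apply/and3P; split; try lia.
  by apply/hasPn => x; rewrite /= !mem_word; lia.
by apply: uniq_perm; rewrite ?iota_uniq // => x; rewrite mem_word mem_iota; lia.
Qed.

(** The position of the largest letter reveals the size of the left subtree, after which the word
    splits uniquely. *)
Lemma word_inj o : injective (word^~ o).
Proof.
move=> t t'; elim: t t' o => [|l IHl r IHr] [|l' r'] o //= e.
- by have := congr1 size e; rewrite size_cat /= addnS.
- by have := congr1 size e; rewrite size_cat /= addnS.
have en : nodes l + nodes r = nodes l' + nodes r'.
  by have := congr1 size e; rewrite !size_cat /= !size_word; lia.
rewrite -en in e.
have := congr1 (index (o + (nodes l + nodes r).+1)) e.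
rewrite !index_cat /= eqxx !mem_word !size_word !ifN; [|lia..].
rewrite !addn0 => el; have er : nodes r = nodes r' by lia.
move/eqP: e; rewrite er eqseq_cat ?size_word //= eqseq_cons eqxx /=.
by case/andP => /eqP /IHl -> /eqP /IHr ->.
Qed.

Lemma word_avoids_132 t o : ~~ contains (word t o) pat132.
Proof.
elim: t o => [|l IHl r IHr] o /=.
  by apply/negP => /contains_132 [a [b [c []]]].
by rewrite (contains_node_132 (word_node _ _ _)) negb_or IHl IHr.
Qed.

(** Strong induction, splitting at the maximum: avoiding 132 puts [L] above [R], so [R] fills the
    low interval of values and [L] the high one. *)
Lemma word_of_avoider o n w :
  perm_eq w (iota o.+1 n) -> ~~ contains w pat132 -> exists t, w = word t o.
Proof.
elim/ltn_ind: n o w => -[|n] IH o w pw av.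
  by exists Leaf; apply/perm_nilP.
have szw := perm_size pw; rewrite size_iota in szw.
have uw : uniq w by rewrite (perm_uniq pw) iota_uniq.
have mw : o + n.+1 \in w by rewrite (perm_mem pw) mem_iota; lia.
case/splitPr: mw pw av szw uw => L R pw av szw uw.
have memw x : (x \in L ++ R) = (o < x <= o + n).
  have := perm_mem pw x; have := uw.
  rewrite -cat_rcons -cats1 -catA uniq_catCA => /andP [nm _].
  rewrite !mem_cat inE mem_iota; case: eqP => [->|ne] /=; last by move=> ->; lia.
  by move=> _; move: nm; rewrite mem_cat => /negbTE ->; lia.
have uLR : uniq (L ++ R).
  by move: uw; rewrite -cat_rcons -cats1 -catA uniq_catCA => /andP [].
have LR x y : x \in L -> y \in R -> y < x.
  (* Otherwise [x], the maximum and [y] would form a 132. *)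
  move=> xL yR; rewrite ltnNge; apply: contra av => xy.
  apply/contains_132; exists x, y, (o + n.+1); split.
    rewrite -[[:: _; _; _]]/([:: x] ++ [:: _; y]); apply: cat_subseq.
      by rewrite sub1seq.
    by rewrite /= eqxx sub1seq.
  have := memw y; rewrite mem_cat yR orbT => yn.
  rewrite ltn_neqAle xy andbT; apply/andP; split; last by lia.
  apply/eqP => exy; move: uLR; rewrite cat_uniq => /and3P [_ /hasPn /(_ y yR)].
  by rewrite /= -exy xL.
have pLR : perm_eq (R ++ L) (iota o.+1 n).
  apply: uniq_perm; rewrite ?iota_uniq 1?uniq_catC // => x.
  by rewrite mem_cat orbC -mem_cat memw mem_iota; lia.
have en : n = size R + size L.
  by have := perm_size pLR; rewrite size_cat size_iota.
(* Since [R] lies below [L], sorting each side sorts the whole; cutting the interval at [size R]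
   then identifies the values on each side. *)
have : sort leq R ++ sort leq L = iota o.+1 n.
  apply: (sorted_eq leq_trans anti_leq); last 1 first.
  - by apply: perm_trans pLR; apply: perm_cat; rewrite perm_sort.
  - rewrite (sorted_pairwise leq_trans) pairwise_cat.
    rewrite -!(sorted_pairwise leq_trans) !(sort_sorted leq_total) !andbT.
    by apply/allrelP => x y; rewrite !mem_sort => xR /LR /(_ xR) /ltnW.
  - by have := iota_ltn_sorted o.+1 n; apply: sub_sorted => x y /ltnW.
rewrite {1}en iotaD => /eqP; rewrite eqseq_cat ?size_sort ?size_iota //.
case/andP => /eqP eR /eqP eL.
have [tr er] : exists t, R = word t o.
  apply: (IH (size R)); first by lia.
    by rewrite -eR perm_sym perm_sort.
  by apply: contra av; apply: subseq_contains;
    apply: subseq_trans (subseq_cons _ _) (suffix_subseq _ _).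
have [tl el] : exists t, L = word t (o + size R).
  apply: (IH (size L)); first by lia.
    by rewrite -addSn -eL perm_sym perm_sort.
  by apply: contra av; apply: subseq_contains; apply: prefix_subseq.
exists (Node tl tr) => /=.
rewrite en {1}el er; congr (_ ++ _ :: _); rewrite ?size_word //.
by rewrite el er !size_word; lia.
Qed.

(** * Alternating words and full trees *)

Fixpoint zigzag (b : bool) (x : nat) (s : seq nat) : bool :=
  if s is y :: s' then (if b then y < x else x < y) && zigzag (~~ b) y s'
  else true.

(** The flag [b], telling whether the next step descends, replaces the parity of positions and
    allows recursion on the word. *)
Lemma zigzag_nth b x s : zigzag b x s =
  [forall i : 'I_(size s), if b (+) odd i
    then nth 0 (x :: s) i > nth 0 (x :: s) i.+1
    else nth 0 (x :: s) i < nth 0 (x :: s) i.+1].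
Proof.
elim: s b x => [|y s IH] b x; first by apply/esym/forallP => -[].
rewrite [LHS]/= IH; apply/andP/forallP => [[h0 /forallP hs] [[|i] hi] /=|h].
- by rewrite addbF.
- by have := hs (Ordinal (hi : i < size s)); rewrite /= addbN addNb.
split; first by have := h ord0; rewrite /= addbF.
apply/forallP => i; have := h (lift ord0 i).
by rewrite /= addbN addNb.
Qed.

Lemma alternating_cons x s : alternating (x :: s) = zigzag false x s.
Proof. by rewrite zigzag_nth. Qed.

Lemma zigzag_cat b x s1 s2 : zigzag b x (s1 ++ s2) =
  zigzag b x s1 && zigzag (b (+) odd (size s1)) (last x s1) s2.
Proof.
elim: s1 b x => [|y s IH] b x /=; first by rewrite addbF.
by rewrite IH andbA addbN addNb.
Qed.

(** As [x :: L] has odd length, [m] stands where a peak is due and being larger than its neighbours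
    suffices; [y] then starts at an even position, so the pattern of steps restarts. *)
Lemma alternating_node x L m y R : ~~ odd (size L) ->
  (forall z, z \in x :: L -> z < m) -> y < m ->
  alternating ((x :: L) ++ m :: y :: R) =
  alternating (x :: L) && alternating (y :: R).
Proof.
move=> oL Lm ym; rewrite /= !alternating_cons zigzag_cat (negbTE oL) /= ym.
by rewrite Lm // mem_last.
Qed.

Lemma alternating_fill t o : alternating (word (fill t) o).
Proof.
elim: t o => [|l IHl r IHr] o; first by rewrite alternating_cons.
rewrite [word _ _]/=.
have [Lm Rm _] := word_node (fill l) (fill r) o.
have := size_word (fill l) (o + nodes (fill r)).
have := size_word (fill r) o.
have := IHl (o + nodes (fill r)); have := IHr o.
move: (word (fill l) _) (word (fill r) _) Lm Rm.
rewrite !nodes_fill => -[|x L] [|y R] Lm Rm; try by rewrite /=; lia.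
move=> aR aL _ szL; rewrite alternating_node ?aL ?aR //.
  have -> : size L = 2 * nodes l by move: szL => /=; lia.
  by rewrite oddM.
by apply: Rm; rewrite mem_head.
Qed.

(** The maximum must be a peak, hence stands at an odd position: the left subtree has odd size, and
    by parity of the total so does the right one. *)
Lemma alternating_word t o : odd (nodes t) -> alternating (word t o) ->
  exists u, t = fill u.
Proof.
elim: t o => [|l IHl r IHr] o //=.
have [Lm Rm _] := word_node l r o.
have szL := size_word l (o + nodes r).
have szR := size_word r o.
have := IHl (o + nodes r); have := IHr o.
(* With an empty left word the maximum comes first, where an ascent is due; so the right word is
   empty too, and the tree is [fill Leaf]. *)
case eL: (word l _) szL Lm => [|x L] /= szL Lm.
  case eR: (word r _) szR Rm => [|y R] /= szR Rm _ _.
    by move: l r szL szR {IHl IHr eL eR Lm Rm} => [|? ?] [|? ?] //; exists Leaf.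
  rewrite alternating_cons /= => _ /andP [].
  by have := Rm y (mem_head _ _); lia.
move=> hR hL od; rewrite alternating_cons zigzag_cat => /and3P [aL].
(* For odd [size L] the step into the maximum would have to descend. *)
case oL: (odd (size L)) => /=.
  by have := Lm (last x L) (mem_last _ _); lia.
move=> _; case eR: (word r _) szR hR => [|y R] /= szR hR; first by lia.
case/andP => _ aR.
have ol : odd (nodes l) by rewrite -szL /= oL.
have [|ul ->] := hL ol; first by rewrite alternating_cons.
have [||ur ->] := hR; [by lia | by rewrite alternating_cons |].
by exists (Node ul ur).
Qed.

(** * The two pattern families along [fill] *)

Lemma contains_size w p : contains w p -> size p <= size w.
Proof. by case/containsP => s /size_subseq h [<- _]. Qed.

(** At a node the filled left subtree is nonempty, and any of its letters followed by the maximum is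
    a 12; a filled [Leaf] has only one letter. *)
Lemma contains_fill_12 t o : contains (word (fill t) o) [:: 1; 2] = (t != Leaf).
Proof.
case: t => [|l r]; first by rewrite eqxx; apply/negbTE/negP => /contains_size.
rewrite [word _ _]/=.
rewrite (contains_node_rcons (p := [:: 1]) (t := 2) (word_node _ _ _)) //.
have := size_word (fill l) (o + nodes (fill r)).
case: (word (fill l) _) => [|x L] /= szL; first by rewrite nodes_fill in szL; lia.
apply/orP; left; apply/containsP; exists [:: x].
  by rewrite /= eqxx sub0seq.
by split=> // -[|i] [|j] //=; rewrite ltnn.
Qed.

(** Induction on the number [j] of appended maxima, then on the tree: the left subtree meets the
    pattern shortened by its last letter, the right one the full pattern. The offsets vary because
    they differ between a tree and its filling. *)
Lemma contains_fill t o o' j :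
  contains (word (fill t) o) ([:: 3; 4; 1; 2] ++ iota 5 j) =
  contains (word t o') ([:: 2; 1] ++ iota 3 j).
Proof.
elim: j t o o' => [|j IHj]; last first.
  move=> t; have iota_rcons a : iota a j.+1 = rcons (iota a j) (a + j).
    by rewrite -addn1 iotaD cats1.
  rewrite !iota_rcons -!rcons_cat.
  elim: t => [|l IHl r IHr] o o'.
    by apply/idP/idP => /contains_size; rewrite ?size_rcons.
  rewrite [word (fill _) _]/= [word (Node _ _) _]/=.
  rewrite !(contains_node_rcons (word_node _ _ _)) //.
  - by rewrite (IHj l _ (o' + nodes r)) (IHr _ o').
  - by apply/allP => x; rewrite mem_cat mem_iota !inE; lia.
  - by apply/allP => x; rewrite mem_cat mem_iota !inE; lia.
(* Base patterns 3412 and 21: a 12 in the filled right subtree corresponds to a nonempty right word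
   before filling. *)
rewrite !cats0; elim=> [|l IHl r IHr] o o'.
  by apply/idP/idP => /contains_size.
rewrite [word (fill _) _]/= [word (Node _ _) _]/=.
rewrite (contains_node_21 (word_node _ _ _)).
rewrite (contains_node_3412 (word_node _ _ _)); last first.
  by rewrite -size_eq0 size_word nodes_fill; lia.
rewrite contains_fill_12 (IHl _ (o' + nodes r)); congr (_ || _).
by rewrite -[_ == [::]]size_eq0 size_word; case: (r).
Qed.

(** * Enumerating trees and transporting the counts *)

Fixpoint trees_upto h : seq btree :=
  if h is h'.+1 then
    Leaf :: [seq Node l r | l <- trees_upto h', r <- trees_upto h']
  else [:: Leaf].

Lemma trees_upto_uniq h : uniq (trees_upto h).
Proof.
elim: h => //= h IH; apply/andP; split.
  by apply/allpairsP => -[[l r] []].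
by apply: allpairs_uniq => // -[l r] [l' r'] _ _ [-> ->].
Qed.

(** The enumeration is bounded by height, which never exceeds the number of nodes. *)
Lemma mem_trees_upto t h : nodes t <= h -> t \in trees_upto h.
Proof.
elim: t h => [|l IHl r IHr] [|h] //= le; rewrite inE.
by apply/orP; right; apply: allpairs_f; [apply: IHl|apply: IHr]; lia.
Qed.

Definition trees n := [seq t <- trees_upto n | nodes t == n].

Lemma mem_trees n t : (t \in trees n) = (nodes t == n).
Proof.
rewrite mem_filter; case: eqP => //= <-.
exact: mem_trees_upto.
Qed.

Lemma trees_uniq n : uniq (trees n).
Proof. exact: filter_uniq (trees_upto_uniq n). Qed.

(** [word^~ 0] maps the trees with [n] nodes bijectively onto the 132-avoiders of length [n]. *)
Lemma s_trees n p :
  s_ n [:: pat132; p] = count (fun t => ~~ contains (word t 0) p) (trees n).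
Proof.
rewrite /s_ -!size_filter -(size_map (word^~ 0)); apply: perm_size.
apply: uniq_perm; first exact: filter_uniq (permutations_uniq _).
  rewrite map_inj_uniq; last exact: word_inj.
  exact: filter_uniq (trees_uniq n).
move=> w; rewrite mem_filter mem_permutations /= andbT.
apply/andP/mapP => [[/andP [av avp] pw]|[t]].
  have [t et] := word_of_avoider pw av; exists t => //.
  have := perm_size pw; rewrite mem_filter mem_trees -et avp et size_word.
  by rewrite size_iota => ->; rewrite eqxx.
rewrite mem_filter mem_trees => /andP [avp /eqP <-] ->.
by rewrite avp word_avoids_132 word_perm.
Qed.

(** Filling and then reading the word is a bijection onto the alternating 132-avoiders, surjective
    by [alternating_word] since the length is odd. *)
Lemma a_trees n p :
  a_ (2 * n + 1) [:: pat132; p] =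
  count (fun t => ~~ contains (word (fill t) 0) p) (trees n).
Proof.
have inj_fill : injective fill.
  (* In the mixed cases, [fill Leaf] has empty children, whereas a child of a filled node is itself
     filled and so never empty. *)
  by elim=> [|l IHl r IHr] [|l' r'] //= [];
    [case: l'|case: l {IHl}|move=> /IHl -> /IHr ->].
rewrite /a_ -!size_filter -(size_map (fun t => word (fill t) 0)).
apply: perm_size.
apply: uniq_perm; first exact: filter_uniq (permutations_uniq _).
  rewrite map_inj_uniq; last by move=> t u /word_inj /inj_fill.
  exact: filter_uniq (trees_uniq n).
move=> w; rewrite mem_filter mem_permutations /= andbT.
apply/andP/mapP => [[/and3P [alt av avp] pw]|[t]].
  have [t et] := word_of_avoider pw av.
  have := perm_size pw; rewrite size_iota et size_word => sz.
  have [||u eu] := @alternating_word t 0; first by lia.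
    by rewrite -et.
  exists u; last by rewrite -eu.
  rewrite mem_filter mem_trees -eu -et avp /=.
  by move: sz; rewrite eu nodes_fill; lia.
rewrite mem_filter mem_trees => /andP [avp /eqP <-] ->.
by rewrite avp word_avoids_132 alternating_fill -nodes_fill word_perm.
Qed.

Theorem corollary4p3 (n k : nat) (hk : 2 <= k) :
  a_ (2 * n + 1) [:: pat132; pat341256 k] = s_ n [:: pat132; pat2134 k].
Proof.
rewrite a_trees s_trees; apply: eq_count => t /=.
by rewrite (contains_fill _ _ 0).
Qed.
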